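(* Let $H$ be an infinite-dimensional Hilbert space over $\mathbf K$ and let $T$ be a compact operator on $H$. Then the spectrum $\sigma(T)$ of $T$ is given by $$\sigma(T)=\{\lambda\in\mathbf K:\delta^{T^*-\bar\lambda I}\in T\mathcal P(H)\}.$$
   Context: $\mathbf K=\mathbb R$ or $\mathbb C$. $\mathcal P(H)$ is the category whose objects are the proper (linear) subspaces of $H$ and whose morphisms are all linear maps between them, with subspace inclusions as inclusions. A cone $\delta$ in $\mathcal P(H)$ with vertex $N$ assigns to each proper subspace $M$ a linear map $\delta(M):M\to N$ such that $\delta(M')=\delta(M)|_{M'}$ whenever $M'\subseteq M$. For a linear operator $S$ on $H$ with range $R(S)$, $\delta^S$ denotes the family $\delta^S(M)=S|_M:M\to R(S)$, which is a cone in $\mathcal P(H)$ with vertex $R(S)$ when $R(S)$ is a proper subspace. $T\mathcal P(H)$ denotes the semigroup of normal cones in $\mathcal P(H)$; it is identified with the semigroup of non-surjective linear operators on $H$ via $S\mapsto\delta^S$, i.e. $T\mathcal P(H)=\{\delta^S:S\text{ a non-surjective linear operator on }H\}$, so that $\delta^S\in T\mathcal P(H)$ means that $S$ is not surjective. $T^*$ is the adjoint of $T$ and $I$ the identity operator. *)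

(* Defs.v *)
From HB Require Import structures.
From mathcomp Require Import all_boot all_order all_algebra.
From mathcomp Require Import all_classical all_reals all_analysis.
From mathcomp Require Import complex.

Set Implicit Arguments.
Unset Strict Implicit.
Unset Printing Implicit Defensive.

Import Order.TTheory GRing.Theory Num.Theory.
Import numFieldNormedType.Exports.

Local Open Scope classical_set_scope.
Local Open Scope ring_scope.

(* [real_or_complex K conj]: K is the field of real numbers with the identity
   as conjugation, or the field of complex numbers with the usual one. *)
Variant real_or_complex :
    forall K : numFieldType, {rmorphism K -> K} -> Prop :=
| RealScalars (R : realType) : @real_or_complex R idfun
| ComplexScalars (R : realType) : @real_or_complex R[i] (@conjc R).

Definition infinite_dimensional (K : numFieldType) (V : lmodType K) :=
  ~ exists (n : nat) (e : 'I_n -> V),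
      forall x : V, exists c : 'I_n -> K, x = \sum_(i < n) c i *: e i.

Section Operators.
Context {K : numFieldType} {H : normedModType K}.
Implicit Types T S : {linear H -> H}.

Definition compact_operator T :=
  forall A : set H, bounded_set A -> precompact (T @` A).

(* The complement of the set of l such that T - l I has an inverse in the
   algebra of bounded operators. *)
Definition spectrum T : set K :=
  [set l | ~ exists S, [/\ continuous S,
                           cancel (T \- l \*: idfun) S
                         & cancel S (T \- l \*: idfun)]].

(* The inner product is linear in its first argument, and conjugate-linear in
   its second one. *)
Definition is_adjoint (conj : K -> K) (dot : {dot H for conj}) T S :=
  forall x y : H, dot (T x) y = dot x (S y).

(* The junk value 0 is only taken when T has no everywhere defined adjoint,
   which never happens for a bounded T on a Hilbert space. *)
Definition adjoint (conj : K -> K) (dot : {dot H for conj}) T :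
    {linear H -> H} :=
  if pselect (exists S, is_adjoint dot T S) is left ex_adj
  then projT1 (cid ex_adj) else \0.

End Operators.

Section SubspaceCategory.
Context {K : numFieldType} {H : lmodType K}.

Section SubspaceType.
Variable M : submodClosed H.

Record subspace_of : predArgType :=
  SubspaceElt { subspace_val :> H; subspace_valP : subspace_val \in M }.

HB.instance Definition _ := [isSub for subspace_val].
HB.instance Definition _ := [Choice of subspace_of by <:].
HB.instance Definition _ :=
  GRing.SubChoice_isSubLmodule.Build K H _ subspace_of (submodClosedP M).

End SubspaceType.

Definition proper (M : submodClosed H) := exists x : H, x \notin M.

Record proper_subspace :=
  ProperSubspace { psub :> submodClosed H; psubP : proper psub }.

(* The vertex is any subspace here, so that the family of restrictions of an
   operator makes sense whether or not the operator is surjective. *)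
Record subspace_family := SubspaceFamily {
  vertex : submodClosed H;
  component : forall M : proper_subspace,
    {linear subspace_of M -> subspace_of vertex} }.

Definition is_cone (d : subspace_family) :=
  proper (vertex d) /\
  forall M' M : proper_subspace, {subset M' <= M} ->
    forall (x : subspace_of M') (y : subspace_of M), \val x = \val y ->
      component d M' x = component d M y.

Section Restrictions.
Variable S : {linear H -> H}.

Definition range_pred : {pred H} := fun y => y \in range S.

Fact range_pred_submod : submod_closed range_pred.
Proof.
split=> [|a u v]; rewrite !unfold_in !inE.
  by exists 0 => //; rewrite linear0.
by move=> [x _ <-] [y _ <-]; exists (a *: x + y) => //; rewrite linearP.
Qed.

HB.instance Definition _ :=
  GRing.isSubmodClosed.Build K H range_pred range_pred_submod.

Fact mem_range_pred x : S x \in range_pred.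
Proof. by rewrite unfold_in inE; exists x. Qed.

Variable M : submodClosed H.

Definition restriction (x : subspace_of M) : subspace_of range_pred :=
  SubspaceElt (mem_range_pred (\val x)).

Fact restriction_linear : linear restriction.
Proof. by move=> a x y; apply: val_inj; rewrite /= !linearP. Qed.

HB.instance Definition _ :=
  GRing.isLinear.Build K (subspace_of M) (subspace_of range_pred) _
    restriction restriction_linear.

End Restrictions.

Definition delta (S : {linear H -> H}) : subspace_family :=
  @SubspaceFamily (range_pred S) (fun M => @restriction S M).

(* The semigroup of normal cones, identified with the semigroup of
   non-surjective linear operators. *)
Definition TP (d : subspace_family) : Prop :=
  exists2 S : {linear H -> H}, ~ set_surj [set: H] [set: H] S & delta S = d.

Fact TP_cone (d : subspace_family) : TP d -> is_cone d.
Proof.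
move=> [S nsurjS <-]; split.
  apply: contra_notP nsurjS => all_range y _.
  have : y \in range_pred S by apply: contra_notT all_range => ?; exists y.
  by rewrite unfold_in inE.
by move=> M' M _ x y xy; apply: val_inj; rewrite /= xy.
Qed.

End SubspaceCategory.

Arguments TP {K} H.

(* Main.v *)
Require Import Defs.
From HB Require Import structures.
From mathcomp Require Import all_boot all_order all_algebra.
From mathcomp Require Import all_classical all_reals all_analysis.
From mathcomp Require Import complex.
From mathcomp Require Import ring.

(** Write A for T - l I and B for T^* - conj l I, so that B is the adjoint of A.
A family of restrictions determines its vertex, which for [delta B] is the
range of B; hence [delta B] lies in [TP H] exactly when B is not surjective
([TP_deltaE]). The theorem therefore says that A is invertible in the bounded
operators if and only if B is surjective.

If A has a bounded inverse S', then for a given y the functional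
x |-> <S' x, y> is represented by some z, and B z = y
([adjoint_surjective]).

Conversely, let B be surjective. Each y = B z satisfies
|<x, y>| <= |A x| |z|, so the vectors x with |A x| <= 1 are weakly bounded,
hence bounded: A is bounded below ([adjoint_surj_bounded_below]). The rest is
the Fredholm alternative.
- For l = 0 a compact operator that is bounded below would send an orthonormal
  sequence to a separated sequence with precompact range, against the
  infinite dimension of H ([compact_not_bounded_below]).
- For l <> 0 the ranges of the powers of A are closed. If A were not onto, they
  would decrease strictly, and unit vectors chosen in each of them orthogonally
  to the next one would again have separated images under T
  ([sub_scalar_surjective]).
So A is bijective and bounded below, and its inverse is bounded.

The scalars are only known to be the field of reals or that of complex numbers,
and norms take their values in them. What the argument needs of completeness
is extracted once for nonnegative scalars, on which the order is total:
infima exist ([ge0_inf]) and integers are cofinal ([ge0_archimedean]). Limit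
points of all kinds are obtained from decreasing sequences of nonempty sets
([cauchy_nested] and [precompact_nested]). *)

Set Implicit Arguments.
Unset Strict Implicit.
Unset Printing Implicit Defensive.

Import Order.TTheory GRing.Theory Num.Theory.
Import numFieldNormedType.Exports.

Local Open Scope classical_set_scope.
Local Open Scope ring_scope.

(** * The scalars *)

Section Scalars.
Context {K : numFieldType} {conj : {rmorphism K -> K}}.
Context (HK : real_or_complex conj).

Lemma conj_mul a : a * conj a = `|a| ^+ 2.
Proof.
case: K conj / HK a => R a /=; last by rewrite sqr_normc.
by rewrite -expr2 real_normK ?num_real.
Qed.

Lemma conj_involutive : involutive conj.
Proof. by case: K conj / HK => R a //=; rewrite conjcK. Qed.

(** For complex scalars these are the real numbers embedded in the plane: the
completeness of the reals transfers to nonnegative scalars through f. *)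
Lemma ge0_realType : exists (R : realType) (f : {rmorphism R -> K}),
  {mono f : x y / x <= y} /\ forall x, 0 <= x -> exists r, x = f r.
Proof.
case: K conj / HK => R.
  by exists R, idfun; split=> // x _; exists x.
exists R, (real_complex R); split=> [x y|x x_ge0]; first exact: lecR.
by have /complex_realP := ger0_real x_ge0.
Qed.

Lemma ge0_archimedean (x : K) : 0 <= x -> exists n : nat, x < n%:R.
Proof.
have [R [f [f_mono f_onto]]] := ge0_realType.
move=> /f_onto [r ->]; exists (Num.truncn r).+1.
by rewrite -(rmorph_nat f) (leW_mono f_mono) truncnS_gt.
Qed.

Lemma invn_lt (e : K) : 0 < e -> exists n : nat, n.+1%:R^-1 < e.
Proof.
move=> e_gt0; have [|n] := @ge0_archimedean e^-1; first by rewrite invr_ge0 ltW.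
move=> en; exists n; rewrite invf_plt ?posrE//.
by rewrite (lt_le_trans en)// ler_nat.
Qed.

Lemma ge0_inf (E : set K) : E !=set0 -> (forall x, E x -> 0 <= x) ->
  exists m, (forall x, E x -> m <= x) /\
            forall e : K, 0 < e -> exists2 x, E x & x < m + e.
Proof.
have [R [f [f_mono f_onto]]] := ge0_realType => -[x0 Ex0] E_ge0.
have infE : has_inf (f @^-1` E).
  split.
    by have [r rE] := f_onto _ (E_ge0 _ Ex0); exists r; rewrite /= -rE.
  by exists 0 => r /= /E_ge0; rewrite -(rmorph0 f) f_mono.
exists (f (inf (f @^-1` E))); split=> [x Ex|e e_gt0].
  have [r rE] := f_onto _ (E_ge0 _ Ex); rewrite rE f_mono ge_inf//=.
    by have [] := infE.
  by rewrite -rE.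
have [r rE] := f_onto _ (ltW e_gt0).
have r_gt0 : 0 < r by rewrite -(leW_mono f_mono) rmorph0 -rE.
have [s Es sr] := inf_adherent r_gt0 infE.
by exists (f s) => //; rewrite rE -rmorphD (leW_mono f_mono).
Qed.

End Scalars.

(** * Decreasing sequences of sets *)

Section NestedSets.
Context {K : numFieldType} {H : completeNormedModType K}.
Implicit Type B : nat -> set H.

(** A cluster point of the filter generated by the B n, in terms of the norm. *)
Definition nested_adherent B p :=
  forall (e : K) n, 0 < e -> exists2 a, B n a & `|p - a| < e.

Lemma nested_filter B : (forall n, B n !=set0) ->
  (forall m n, (m <= n)%N -> B n `<=` B m) ->
  ProperFilter (filter_from setT B).
Proof.
move=> B0 decB; apply: filter_from_proper => //.
apply: filter_fromT_filter; first by exists 0%N.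
move=> m n; exists (maxn m n); rewrite subsetI.
by split; apply: decB; rewrite ?leq_maxl ?leq_maxr.
Qed.

Lemma cluster_adherent B p :
  cluster (filter_from setT B) p -> nested_adherent B p.
Proof.
move=> Bp e n e_gt0.
have [||a [Ba pa]] := Bp (B n) (ball p e); first by exists n.
  exact: nbhsx_ballx.
by exists a => //; move: pa; rewrite -ball_normE.
Qed.

Lemma cauchy_nested B : (forall n, B n !=set0) ->
  (forall m n, (m <= n)%N -> B n `<=` B m) ->
  (forall e : K, 0 < e ->
     exists n, forall a b, B n a -> B n b -> `|a - b| < e) ->
  exists p, nested_adherent B p.
Proof.
move=> B0 decB smallB; have FB := nested_filter B0 decB.
have /cauchy_cvg cvgB : cauchy (filter_from setT B).
  apply/cauchy_exP => e /smallB [n Bn]; have [a Ba] := B0 n; exists a.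
  by exists n => // b Bb; rewrite -ball_normE; exact: Bn.
exists (lim (filter_from setT B)); apply: cluster_adherent => C D BC nD.
have BD : filter_from setT B D by exact: cvgB nD.
exact: (@filter_ex _ _ FB _ (filterI BC BD)).
Qed.

Lemma precompact_nested (P : set H) B :
  precompact P -> (forall n, B n !=set0) ->
  (forall m n, (m <= n)%N -> B n `<=` B m) -> B 0%N `<=` P ->
  exists p, nested_adherent B p.
Proof.
rewrite precompactE => cP B0 decB BP; have FB := nested_filter B0 decB.
have [|p [_ Bp]] := cP _ FB; last by exists p; exact: cluster_adherent.
by exists 0%N => // a /BP; exact: subset_closure.
Qed.

End NestedSets.

(** * Hilbert spaces *)

Section InnerProduct.
Context {K : numFieldType} {conj : {rmorphism K -> K}}.
Context (HK : real_or_complex conj).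
Context {H : completeNormedModType K} {dot : {dot H for conj}}.
Context (Hdot : forall x : H, `|x| ^+ 2 = dot x x).
Implicit Types (u v w x y z : H) (M : set H).

Lemma dotC u v : dot u v = conj (dot v u).
Proof. by rewrite (hermC dot) expr0 mul1r. Qed.

Lemma dotZl a u v : dot (a *: u) v = a * dot u v.
Proof. exact: linearZl_LR. Qed.

Lemma dotZr a u v : dot u (a *: v) = conj a * dot u v.
Proof. exact: (linearZr_LR dot u a v). Qed.

Lemma dot_mulC u v : dot u v * dot v u = `|dot u v| ^+ 2.
Proof. by rewrite (dotC v u) (conj_mul HK). Qed.

Lemma norm_dotC u v : `|dot u v| = `|dot v u|.
Proof.
by apply: (@pexpIrn _ 2); rewrite ?nnegrE// -!dot_mulC mulrC.
Qed.

Lemma conj_norm2 u : conj (`|u| ^+ 2) = `|u| ^+ 2.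
Proof. by rewrite Hdot -dotC. Qed.

Lemma norm2D u v : `|u + v| ^+ 2 = `|u| ^+ 2 + `|v| ^+ 2 + (dot u v + dot v u).
Proof. by rewrite !Hdot linearDl !linearDr /=; ring. Qed.

Lemma norm2B u v : `|u - v| ^+ 2 = `|u| ^+ 2 + `|v| ^+ 2 - (dot u v + dot v u).
Proof. by rewrite norm2D normrN linearNl linearNr /= -opprD. Qed.

Lemma parallelogram u v :
  `|u + v| ^+ 2 + `|u - v| ^+ 2 = 2 * (`|u| ^+ 2 + `|v| ^+ 2).
Proof. by rewrite norm2D norm2B; ring. Qed.

Lemma ler_norm_orthogonal u v : dot u v = 0 -> `|u| <= `|u + v|.
Proof.
move=> uv0; rewrite -(@ler_pXn2r _ 2) ?nnegrE//.
by rewrite norm2D (dotC v) uv0 rmorph0 !addr0 lerDl exprn_ge0.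
Qed.

(** The norm of the component of u orthogonal to v, by Pythagoras. *)
Lemma norm2_sub_line u v : v != 0 ->
  `|u - (dot u v / `|v| ^+ 2) *: v| ^+ 2 =
  `|u| ^+ 2 - `|dot u v| ^+ 2 / `|v| ^+ 2.
Proof.
move=> v0; have nv0 : `|v| ^+ 2 != 0 by rewrite expf_neq0 ?normr_eq0.
rewrite -dot_mulC norm2B dotZl dotZr normrZ exprMn -(conj_mul HK).
rewrite rmorphM fmorphV conj_norm2 -dotC.
by field; rewrite normr_eq0.
Qed.

Lemma cauchy_schwarz u v : `|dot u v| <= `|u| * `|v|.
Proof.
have [->|v0] := eqVneq v 0; first by rewrite linear0r !normr0 mulr0.
have nv_gt0 : 0 < `|v| ^+ 2 by rewrite exprn_gt0 ?normr_gt0.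
rewrite -(@ler_pXn2r _ 2) ?nnegrE ?mulr_ge0// exprMn -ler_pdivrMr//.
by rewrite -subr_ge0 -norm2_sub_line ?exprn_ge0.
Qed.

Lemma dot_injr u v : (forall x, dot x u = dot x v) -> u = v.
Proof.
move=> uv; apply/eqP; rewrite -subr_eq0 -normr_eq0 -sqrf_eq0 Hdot.
by rewrite linearBr /= uv subrr.
Qed.

(** Closedness is expressed by approximation, the form in which
[nested_adherent] delivers limits. *)
Definition closed_subspace M := [/\ M 0,
  forall a u v, M u -> M v -> M (a *: u + v)
  & forall p, (forall e : K, 0 < e -> exists2 a, M a & `|p - a| < e) -> M p].

Lemma subspaceZ M a u : closed_subspace M -> M u -> M (a *: u).
Proof. by move=> [M0 ML _] Mu; rewrite -[_ *: _]addr0; exact: ML. Qed.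

Lemma subspaceD M u v : closed_subspace M -> M u -> M v -> M (u + v).
Proof. by move=> [_ ML _] Mu Mv; rewrite -[u]scale1r; exact: ML. Qed.

Lemma subspaceB M u v : closed_subspace M -> M u -> M v -> M (u - v).
Proof.
by move=> HM Mu Mv; apply: subspaceD => //; rewrite -scaleN1r; exact: subspaceZ.
Qed.

(** Otherwise moving p along m would bring it closer to x, by
[norm2_sub_line]. *)
Lemma nearest_orthogonal M x p : closed_subspace M -> M p ->
  (forall m, M m -> `|x - p| ^+ 2 <= `|x - m| ^+ 2) ->
  forall m, M m -> dot (x - p) m = 0.
Proof.
move=> HM Mp near_p m Mm; have [->|m0] := eqVneq m 0; first by rewrite linear0r.
have nm_gt0 : 0 < `|m| ^+ 2 by rewrite exprn_gt0 ?normr_gt0.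
have := near_p _
  (subspaceD HM Mp (subspaceZ (dot (x - p) m / `|m| ^+ 2) HM Mm)).
rewrite opprD addrA norm2_sub_line// lerDl oppr_ge0.
rewrite pmulr_lle0 ?invr_gt0// => dot_le0; apply/eqP; rewrite -normr_eq0.
by rewrite -sqrf_eq0 eq_le dot_le0 exprn_ge0.
Qed.

(** By the parallelogram identity, the points of M that nearly minimize the
distance to x are close to each other; their limit is the nearest point. *)
Lemma orthogonal_projection M x : closed_subspace M ->
  exists p, M p /\ forall m, M m -> dot (x - p) m = 0.
Proof.
move=> HM; have [M0 ML Mcl] := HM.
have [||d [d_le d_inf]] :=
    ge0_inf HK (E := [set `|x - m| ^+ 2 | m in M]).
- by exists (`|x - 0| ^+ 2), 0.
- by move=> _ [m _ <-]; rewrite exprn_ge0.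
pose B n := [set m | M m /\ `|x - m| ^+ 2 < d + n.+1%:R^-1].
have B_dist n a b : B n a -> B n b -> `|a - b| ^+ 2 <= 4 * n.+1%:R^-1.
  move=> [Ma Ba] [Mb Bb].
  have mid : 4 * d <= `|(x - b) + (x - a)| ^+ 2.
    have -> : (x - b) + (x - a) = 2 *: (x - 2^-1 *: (a + b)).
      rewrite scalerBr scalerA divff ?pnatr_eq0// scale1r scaler_nat mulr2n.
      by rewrite [a + b]addrC opprD addrACA.
    rewrite normrZ exprMn normr_nat -natrX ler_pM2l ?ltr0n//.
    apply: d_le; exists (2^-1 *: (a + b)) => //.
    by apply: subspaceZ => //; exact: subspaceD.
  have -> : a - b = (x - b) - (x - a) by rewrite opprB [RHS]addrC subrKA.
  rewrite -(lerD2l (4 * d)) (le_trans (lerD mid (lexx _)))//.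
  have -> : 4 * d + 4 * n.+1%:R^-1 = 2 * ((d + n.+1%:R^-1) + (d + n.+1%:R^-1)).
    by ring.
  by rewrite parallelogram ler_pM2l ?ltr0n// ltW// ltrD.
have [|||p Bp] := cauchy_nested (B := B).
- move=> n; have [|_ [m Mm <-] mn] := d_inf n.+1%:R^-1; last by exists m.
  by rewrite invr_gt0.
- move=> i j ij a [Ma Ba]; split=> //; apply: (lt_le_trans Ba).
  by rewrite lerD2l lef_pV2 ?posrE// ler_nat.
- move=> e e_gt0; have [|n ne] := invn_lt HK (e := e ^+ 2 / 4).
    by rewrite divr_gt0 ?exprn_gt0.
  exists n => a b Ba Bb; have ab := B_dist _ _ _ Ba Bb.
  rewrite -(@ltr_pXn2r _ 2) ?nnegrE// ?ltW//.
  by rewrite (le_lt_trans ab)// mulrC -ltr_pdivlMr.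
have Mp : M p.
  by apply: Mcl => e e_gt0; have [a [Ma _]] := Bp e 0%N e_gt0; exists a.
exists p; split=> //; apply: nearest_orthogonal => // m Mm.
rewrite ler_pXn2r ?nnegrE// real_leNgt ?normr_real//; apply/negP => mp.
pose g := (`|x - p| - `|x - m|) / 2.
have g_gt0 : 0 < g by rewrite divr_gt0// subr_gt0.
have [n ng] := invn_lt HK (exprn_gt0 2 g_gt0).
have [a [Ma Ba] pa] := Bp g n g_gt0.
(* If m were nearer to x than p, a close enough to p would be farther from x
   than m by a definite amount g, which nearly minimizing points are not. *)
have gE : `|x - m| + g + g = `|x - p| by rewrite /g; field.
have : `|x - m| + g <= `|x - a|.
  rewrite -(lerD2r g) gE -(subrKA a) (le_trans (ler_normD _ _))//.
  by rewrite lerD2l distrC ltW.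
rewrite -(@ler_pXn2r _ 2) ?nnegrE ?addr_ge0 ?(ltW g_gt0)//.
move=> /le_lt_trans/(_ Ba)/lt_trans/(_ (_ : _ < d + g ^+ 2)).
rewrite ltrD2l => /(_ ng)/lt_geF/negP; apply.
have dm : d <= `|x - m| ^+ 2 by apply: d_le; exists m.
by rewrite sqrrD lerD// ler_wpDr// mulrn_wge0// mulr_ge0// ltW.
Qed.

(** The kernel M of f is closed. If f <> 0, a vector w orthogonal to M has
f w <> 0, and f w *: x - f x *: w lies in M for all x, so that a multiple of w
represents f. *)
Lemma riesz_representation (f : H -> K) C : 0 < C ->
  (forall a u v, f (a *: u + v) = a * f u + f v) ->
  (forall x, `|f x| <= C * `|x|) -> exists z, forall x, f x = dot x z.
Proof.
move=> C_gt0 fL fC; have f0 : f 0 = 0.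
  apply/normr0_eq0/le_anti.
  by rewrite normr_ge0 (le_trans (fC 0))// normr0 mulr0.
have [f_eq0|/existsNP [x0 /eqP fx0]] := pselect (forall x, f x = 0).
  by exists 0 => x; rewrite f_eq0 linear0r.
have fB u v : f (u - v) = f u - f v.
  by rewrite addrC -scaleN1r fL mulN1r addrC.
have HM : closed_subspace [set u | f u = 0].
  split=> //= [a u v fu fv|p Mp]; first by rewrite fL fu fv mulr0 addr0.
  apply/eqP/negPn/negP; rewrite -normr_gt0 => fp.
  have [a fa pa] := Mp _ (divr_gt0 fp C_gt0).
  have := fC (p - a); rewrite fB fa subr0 => /le_lt_trans.
  move=> /(_ _ (_ : _ < `|f p|)); rewrite -ltr_pdivlMl// mulrC ltxx.
  by move=> /(_ pa).
have [p [fp px]] := orthogonal_projection x0 HM.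
pose w := x0 - p; have fw : f w != 0 by rewrite fB fp subr0.
have w0 : `|w| ^+ 2 != 0.
  by rewrite sqrf_eq0 normr_eq0; apply: contraNneq fw => ->; rewrite f0.
exists ((conj (f w) / `|w| ^+ 2) *: w) => x.
have : dot w (f w *: x - f x *: w) = 0.
  apply: px; rewrite /= fB -[_ *: x]addr0 -[_ *: w]addr0 !fL f0 !addr0.
  by rewrite mulrC subrr.
move=> /(congr1 conj); rewrite -dotC rmorph0 linearBl /= !dotZl -Hdot.
move=> /subr0_eq fxw; rewrite dotZr rmorphM fmorphV conj_norm2.
by rewrite (conj_involutive HK) mulrAC fxw mulfK.
Qed.

Lemma adjoint_exists (T : {linear H -> H}) C : 0 < C ->
  (forall x, `|T x| <= C * `|x|) -> exists S, is_adjoint dot T S.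
Proof.
move=> C_gt0 TC.
have rep y : exists z, forall x, dot (T x) y = dot x z.
  apply: (@riesz_representation _ (C * (`|y| + 1))).
  - by rewrite mulr_gt0// ltr_wpDl.
  - by move=> a u v; rewrite linearP linearDl /= dotZl.
  - move=> x; rewrite (le_trans (cauchy_schwarz _ _))// mulrAC.
    by rewrite ler_pM// lerDl.
have [S TS] := choice rep.
have SL : linear S.
  move=> a y z; apply: dot_injr => x.
  by rewrite -TS !linearDr /= !dotZr !TS.
pose S' : {linear H -> H} := HB.pack S (GRing.isLinear.Build _ _ _ _ S SL).
by exists S' => x y; exact: TS.
Qed.

End InnerProduct.

(** * Operators bounded below *)

Section BoundedBelow.
Context {K : numFieldType} {conj : {rmorphism K -> K}}.
Context (HK : real_or_complex conj).
Context {H : completeNormedModType K} {dot : {dot H for conj}}.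
Context (Hdot : forall x : H, `|x| ^+ 2 = dot x x).
Implicit Types (A T S : {linear H -> H}) (u v x y : H).

Definition bounded_operator A :=
  exists2 C : K, 0 < C & forall x, `|A x| <= C * `|x|.

Definition bounded_below A :=
  exists2 C : K, 0 < C & forall x, `|x| <= C * `|A x|.

Lemma not_bounded_below A (C : K) : ~ bounded_below A -> 0 < C ->
  exists x, `|x| = 1 /\ C * `|A x| <= 1.
Proof.
move=> nbA C_gt0.
have /existsNP [x] : ~ forall x, `|x| <= C * `|A x|.
  by move=> AC; apply: nbA; exists C.
move/negP; rewrite -real_ltNge ?realM ?normr_real ?gtr0_real// => Cx.
have x_gt0 : 0 < `|x|.
  by rewrite (le_lt_trans _ Cx)// mulr_ge0// ltW.
exists (`|x|^-1 *: x); rewrite linearZ !normrZ normfV normr_id mulVf ?gt_eqF//.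
by split=> //; rewrite mulrCA -ler_pdivlMl ?invr_gt0// invrK mulr1 ltW.
Qed.

Lemma ler_normB_normD_lt (a b : K) : 0 <= b -> `|a + b| < b -> b <= `|a - b|.
Proof.
move=> b_ge0 ab; have -> : a - b = (a + b) - 2 * b by ring.
rewrite distrC (le_trans _ (lerB_dist _ _))// ger0_norm ?mulr_ge0// lerBrDr.
by rewrite [2 * b]mulr_natl mulr2n lerD2l ltW.
Qed.

(** The uniform boundedness principle for the functionals <., x>, with |A x|
small, which are pointwise bounded on the range of S. A sliding hump with
signs replaces the Baire category argument. If A is not bounded below, there are
unit vectors x n with |A (x n)| <= 3 ^- n / (n + 1). Adding 3 ^- n *: x n or
its opposite at step n gives |<u (n + 1), x n>| >= 3 ^- n, and the following
steps, of total length 3 ^- n / 2, leave at least half of it at the limit p.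
But p = S z gives |<p, x n>| <= |A (x n)| |z|, which is much smaller. *)
Lemma adjoint_surj_bounded_below A S :
  is_adjoint dot A S -> (forall y, exists z, S z = y) -> bounded_below A.
Proof.
move=> AS surjS; apply/not_notP => nbA.
pose r n : K := 3^-1 ^+ n.
have r_gt0 n : 0 < r n by rewrite exprn_gt0.
have rS n : r n = 3 * r n.+1 by rewrite /r exprS mulrA divff ?mul1r// pnatr_eq0.
have rI n : r n = (3 / 2) * (r n - r n.+1) by rewrite rS; field.
have /choice [x x_small] n : exists x, `|x| = 1 /\ n.+1%:R / r n * `|A x| <= 1.
  by apply: not_bounded_below => //; rewrite divr_gt0.
(* One of the two signs makes the product with x n at least r n, since the
   two products differ by 2 * r n. *)
pose step n v := if r n <= `|dot (v + r n *: x n) (x n)|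
                 then v + r n *: x n else v - r n *: x n.
pose fix u n : H := if n is m.+1 then step m (u m) else 0.
have norm_rx n : `|r n *: x n| = r n.
  by rewrite normrZ (x_small n).1 mulr1 gtr0_norm.
have dot_rx n : dot (r n *: x n) (x n) = r n.
  by rewrite dotZl -Hdot (x_small n).1 expr1n mulr1.
have u_dist n : `|u n.+1 - u n| = r n.
  rewrite /= /step; case: ifP => _; first by rewrite addrC addKr norm_rx.
  by rewrite addrC addKr normrN norm_rx.
have u_dot n : r n <= `|dot (u n.+1) (x n)|.
  rewrite /= /step; case: ifP => //; rewrite linearDl linearBl /= dot_rx.
  move/negbT; rewrite -real_ltNge ?normr_real ?gtr0_real//.
  by move=> /ler_normB_normD_lt; apply; rewrite ltW.
(* The bound is the sum of r i for n <= i < k + n. *)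
have u_tail n k : `|u (k + n)%N - u n| <= 3 / 2 * (r n - r (k + n)%N).
  elim: k => [|k IH]; first by rewrite !subrr normr0 mulr0.
  rewrite -(subrKA (u (k + n)%N)) (le_trans (ler_normD _ _))//.
  have -> : 3 / 2 * (r n - r (k.+1 + n)%N) =
      3 / 2 * (r (k + n)%N - r (k + n).+1) + 3 / 2 * (r n - r (k + n)%N).
    by rewrite addSn; ring.
  rewrite addSn u_dist.
  by rewrite -rI lerD2l.
have u_cauchy n k : `|u (k + n)%N - u n| <= 3 / 2 * r n.
  rewrite (le_trans (u_tail n k))// ler_pM2l ?divr_gt0// gerDl oppr_le0.
  exact: ltW.
pose B n := [set u k | k in [set k | (n <= k)%N]].
have r_inv n : r n <= n.+1%:R^-1.
  rewrite /r exprVn lef_pV2 ?posrE ?exprn_gt0// -natrX ler_nat.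
  exact: ltn_expl.
have [|||p Bp] := cauchy_nested (B := B).
- by move=> n; exists (u n), n => /=.
- by move=> m n mn _ [k /= nk <-]; exists k => //=; exact: leq_trans mn nk.
- move=> e e_gt0; have [|n ne] := invn_lt HK (e := e / 3).
    by rewrite divr_gt0.
  exists n => _ _ [i /= ni <-] [j /= nj <-].
  rewrite -(subrKA (u n)) (le_lt_trans (ler_normD _ _))// [`|u n - _|]distrC.
  rewrite -(subnK ni) -(subnK nj).
  rewrite (le_lt_trans (lerD (u_cauchy _ _) (u_cauchy _ _)))//.
  rewrite (_ : _ + _ = 3 * r n); last by field.
  by rewrite -ltr_pdivlMl// mulrC (le_lt_trans (r_inv n)).
have p_dist n : `|p - u n| <= 3 / 2 * r n.
  apply/ler_addgt0Pr => e e_gt0; have [_ [k /= nk <-] pk] := Bp e n e_gt0.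
  rewrite -(subrKA (u k)) (le_trans (ler_normD _ _))// addrC.
  rewrite lerD//; last exact: ltW.
  by rewrite -(subnK nk).
have [z Sz] := surjS p.
have [|n zn] := ge0_archimedean HK (x := 2 * `|z|); first by rewrite mulr_ge0.
have : r n / 2 <= `|dot p (x n)|.
  have near_u : `|dot (u n.+1 - p) (x n)| <= 3 / 2 * r n.+1.
    rewrite (le_trans (cauchy_schwarz HK Hdot _ _))// (x_small n).1 mulr1.
    by rewrite distrC p_dist.
  have -> : p = u n.+1 - (u n.+1 - p) by rewrite opprB addrC subrK.
  rewrite linearBl /= (le_trans _ (lerB_dist _ _))// lerBrDr.
  rewrite (le_trans _ (u_dot n))// (le_trans (lerD (lexx _) near_u))//.
  by rewrite rS le_eqVlt; apply/orP; left; apply/eqP; field.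
rewrite -Sz (norm_dotC HK) -AS => /le_trans/(_ (cauchy_schwarz HK Hdot _ _)).
move=> rAz; have [_] := x_small n; rewrite mulrAC ler_pdivrMr// mul1r => Ax.
have : r n * n.+1%:R <= r n * (2 * `|z|).
  rewrite mulrCA -ler_pdivrMl// mulrA [2^-1 * _]mulrC.
  rewrite (le_trans (ler_wpM2r (ler0n _ n.+1) rAz))// mulrAC mulrC.
  by rewrite [leRHS]mulrC ler_wpM2l// mulrC.
rewrite ler_pM2l// => /le_lt_trans/(_ zn).
by rewrite ltr_nat ltnNge leqnSn.
Qed.

End BoundedBelow.

(** * Compact operators *)

Section Compact.
Context {K : numFieldType} {conj : {rmorphism K -> K}}.
Context (HK : real_or_complex conj).
Context {H : completeNormedModType K} {dot : {dot H for conj}}.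
Context (Hdot : forall x : H, `|x| ^+ 2 = dot x x).
Context {T : {linear H -> H}}.
Context (HT : compact_operator T).
Implicit Types (A : {linear H -> H}) (u v x y : H).

Let ball1 : set H := [set x | `|x| <= 1].

Lemma precompact_unit_image : precompact (T @` ball1).
Proof.
apply: HT; exists 1; split=> [|M /ltW M1 x x1]; first exact: real1.
exact: le_trans x1 M1.
Qed.

(** Otherwise the images of norm greater than n would have a cluster point, of
norm greater than every n. *)
Lemma compact_operator_bounded : bounded_operator T.
Proof.
have [[n Tn]|unbounded] :=
    pselect (exists n, forall x, `|x| <= 1 -> `|T x| <= n%:R).
  exists n.+1%:R => // x; have [->|x0] := eqVneq x 0.
    by rewrite linear0 !normr0 mulr0.
  have x_gt0 : 0 < `|x| by rewrite normr_gt0.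
  rewrite -ler_pdivrMr// mulrC -[in leLHS](normr_id x) -normfV -normrZ -linearZ.
  rewrite (le_trans (Tn _ _)) ?ler_nat//.
  by rewrite normrZ normfV normr_id mulVf ?gt_eqF.
pose B n := [set T x | x in [set x | `|x| <= 1 /\ n%:R < `|T x| :> K]].
have [|||p Bp] := precompact_nested (B := B) precompact_unit_image.
- move=> n; apply/not_notP => B0; apply: unbounded; exists n => x x1.
  rewrite real_leNgt ?normr_real//; apply/negP => nTx.
  by apply: B0; exists (T x), x.
- move=> m n mn _ [x [x1 nx] <-]; exists x => //; split=> //.
  by rewrite (le_lt_trans _ nx)// ler_nat.
- by move=> _ [x [x1 _] <-]; exists x.
have [|n pn] := ge0_archimedean HK (x := `|p| + 1); first by rewrite addr_ge0.
have [_ [x [x1 nTx] <-] pTx] := Bp 1 n ltr01.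
have : `|T x| <= `|p| + 1.
  rewrite -(subrK p (T x)) (le_trans (ler_normD _ _))// addrC lerD2l distrC.
  exact: ltW.
by move=> /le_lt_trans/(_ pn)/lt_trans/(_ nTx); rewrite ltxx.
Qed.

Lemma compact_operator_not_separated (v : nat -> H) (c : K) :
  (forall n, `|v n| <= 1) -> 0 < c ->
  ~ forall m n, (m < n)%N -> c <= `|T (v m) - T (v n)|.
Proof.
move=> v1 c_gt0 sepv.
pose B n := [set T (v k) | k in [set k | (n <= k)%N]].
have [|||p Bp] := precompact_nested (B := B) precompact_unit_image.
- by move=> n; exists (T (v n)), n => /=.
- by move=> m n mn _ [k /= nk <-]; exists k => //=; exact: leq_trans mn nk.
- by move=> _ [k _ <-]; exists (v k) => //; exact: v1.
have c2_gt0 : 0 < c / 2 by rewrite divr_gt0.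
have [_ [m _ <-] pm] := Bp _ 0%N c2_gt0.
have [_ [n /= mn <-] pn] := Bp _ m.+1 c2_gt0.
have := sepv _ _ mn; apply/negP; rewrite -real_ltNge ?normr_real ?gtr0_real//.
rewrite -(subrKA p) (le_lt_trans (ler_normD _ _))// (splitr c) ltrD//.
by rewrite distrC.
Qed.

(** If there were none, every vector would be equal to its projection on the
span of s. *)
Lemma orthogonal_unit_vector (s : seq H) : infinite_dimensional H ->
  orthonormal dot s -> exists x, `|x| = 1 /\ forall e, e \in s -> dot x e = 0.
Proof.
move=> Hinf; have proj (t : seq H) y : orthonormal dot t ->
    forall e, e \in t -> dot (y - \sum_(i < size t) dot y t`_i *: t`_i) e = 0.
  elim: t => [//|a t IH] /andP [] /= /andP [/eqP a1 t1] /andP[].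
  rewrite /ortho_rec /= andbT => /allP at0 tt.
  have {}IH : _ := IH (introT andP (Logic.conj t1 tt)).
  move=> e; rewrite big_ord_recl/= inE => /predU1P [->|et].
    rewrite linearBl /= linearDl/= dotZl a1 mulr1 opprD addrA subrr add0r.
    rewrite linear_sumlz big1 ?oppr0// => i _; rewrite /= dotZl (dotC t`_i).
    by have /= /eqP -> := at0 _ (mem_nth 0 (ltn_ord i)); rewrite rmorph0 mulr0.
  rewrite opprD addrA addrAC linearBl /= IH// dotZl.
  by have /= /eqP -> := at0 _ et; rewrite mulr0 subrr.
move=> s_on; apply/not_notP => noperp; apply: Hinf.
exists (size s), (fun i => s`_i) => y; exists (fun i => dot y s`_i).
apply/eqP; rewrite -subr_eq0; apply/negPn/negP => y0; apply: noperp.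
set z := y - _ in y0; exists (`|z|^-1 *: z); split.
  by rewrite normrZ normfV normr_id mulVf ?normr_eq0.
by move=> e es; rewrite dotZl /z proj// mulr0.
Qed.

Lemma orthonormal_sequence : infinite_dimensional H ->
  exists e : nat -> H, (forall n, `|e n| = 1) /\
    forall m n, (m < n)%N -> dot (e m) (e n) = 0.
Proof.
move=> Hinf.
have /choice [next nextP] s : exists x, orthonormal dot s ->
    `|x| = 1 /\ forall e, e \in s -> dot x e = 0.
  have [s_on|] := boolP (orthonormal dot s); last by exists 0.
  by have [x ?] := orthogonal_unit_vector Hinf s_on; exists x.
pose l n := iter n (fun s => next s :: s) [::].
have l_on n : orthonormal dot (l n).
  elim: n => // n ln; have [n1 n0] := nextP _ ln.
  have /andP [ln1 ln2] := ln.
  rewrite /orthonormal /= ln1 ln2 -Hdot n1 expr1n eqxx /= andbT.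
  rewrite /ortho_rec /= andbT.
  by apply/allP => e /n0 /= ->.
exists (next \o l); split=> [n|m n mn] /=; first exact: (nextP _ (l_on n)).1.
rewrite (dotC (next _)) (nextP _ (l_on n)).2 ?rmorph0//.
elim: n mn => // n IH; rewrite ltnS leq_eqVlt inE => /predU1P [->|/IH ->].
  by rewrite eqxx.
by rewrite orbT.
Qed.

(** The terms of an orthonormal sequence are at distance at least 1 from each
other, so their images would be separated. *)
Lemma compact_not_bounded_below : infinite_dimensional H -> ~ bounded_below T.
Proof.
move=> /orthonormal_sequence [e [e1 e0]] [C C_gt0 TC].
apply: (@compact_operator_not_separated e C^-1).
- by move=> n; rewrite e1.
- by rewrite invr_gt0.
move=> m n /e0 emn; rewrite -linearB -[leLHS]mulr1 ler_pdivrMl//.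
rewrite (le_trans _ (TC _))// -(e1 m) (ler_norm_orthogonal Hdot)//.
by rewrite linearNr /= emn oppr0.
Qed.

End Compact.

(** * The Fredholm alternative *)

Section FredholmAlternative.
Context {K : numFieldType} {conj : {rmorphism K -> K}}.
Context (HK : real_or_complex conj).
Context {H : completeNormedModType K} {dot : {dot H for conj}}.
Context (Hdot : forall x : H, `|x| ^+ 2 = dot x x).
Implicit Types (A S T : {linear H -> H}) (u v x y : H) (M : set H).

Lemma bounded_operator_continuous A : bounded_operator A <-> continuous A.
Proof.
split=> [[C C_gt0 AC]|/(_ 0) A_cont].
  apply: bounded_linear_continuous; apply/bounded_funP => r.
  by exists (C * r) => x xr; rewrite (le_trans (AC x))// ler_pM2l.
have /linear_boundedP/pinfty_ex_gt0 [C C_gt0 AC] :=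
  continuous_linear_bounded 0 A_cont.
by exists C.
Qed.

Lemma bounded_operator_sub_scalar T (l : K) :
  bounded_operator T -> bounded_operator (T \- l \*: idfun).
Proof.
move=> [C C_gt0 TC]; exists (C + `|l|) => [|x]; first by rewrite ltr_wpDr.
by rewrite /= (le_trans (ler_normB _ _))// normrZ mulrDl lerD2r.
Qed.

Lemma bounded_below_injective A : bounded_below A -> injective A.
Proof.
move=> [C _ AC] u v uv; apply/eqP; rewrite -subr_eq0 -normr_le0.
by rewrite (le_trans (AC _))// linearB uv subrr normr0 mulr0.
Qed.

(** The preimages of a Cauchy sequence under an operator bounded below form a
Cauchy sequence. *)
Lemma closed_image A M : bounded_operator A -> bounded_below A ->
  closed_subspace M -> closed_subspace (A @` M).
Proof.
move=> [C C_gt0 AC] [D D_gt0 AD] [M0 ML Mcl].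
split=> [|a _ _ [u Mu <-] [v Mv <-]|p Mp].
- by exists 0 => //; rewrite linear0.
- by exists (a *: u + v); [exact: ML|rewrite linearP].
pose B n := [set x | M x /\ `|p - A x| < n.+1%:R^-1].
have [|||q Bq] := cauchy_nested (B := B).
- move=> n; have [|_ [x Mx <-] px] := Mp n.+1%:R^-1; last by exists x.
  by rewrite invr_gt0.
- move=> m n mn x [Mx px]; split=> //; apply: (lt_le_trans px).
  by rewrite lef_pV2 ?posrE// ler_nat.
- move=> e e_gt0; have [|n ne] := invn_lt HK (e := e / (2 * D)).
    by rewrite divr_gt0// mulr_gt0.
  exists n => a b [_ pa] [_ pb]; rewrite (le_lt_trans (AD _))// linearB.
  rewrite mulrC -ltr_pdivlMr// -(subrKA p) (le_lt_trans (ler_normD _ _))//.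
  rewrite (splitr (e / D)) ltrD// 1?distrC.
    by rewrite (lt_trans pa)// -mulrA -invfM [D * 2]mulrC.
  by rewrite distrC (lt_trans pb)// -mulrA -invfM [D * 2]mulrC.
have Mq : M q.
  by apply: Mcl => e e_gt0; have [a [Ma _]] := Bq e 0%N e_gt0; exists a.
exists q => //; apply/esym/eqP; rewrite -subr_eq0 -normr_le0 real_leNgt//.
apply/negP => pq.
have pq2 : 0 < `|p - A q| / 2 by rewrite divr_gt0.
have [n npq] := invn_lt HK pq2.
have [a [_ pa] qa] := Bq _ n (divr_gt0 pq2 C_gt0).
suff : `|p - A q| < `|p - A q| by rewrite ltxx.
rewrite -{1}(subrKA (A a)) (le_lt_trans (ler_normD _ _))// [ltRHS]splitr.
rewrite ltrD ?(lt_trans pa)// -linearB (le_lt_trans (AC _))//.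
by rewrite mulrC -ltr_pdivlMr// distrC.
Qed.

Fixpoint power_range A n : set H :=
  if n is m.+1 then A @` power_range A m else setT.

Lemma power_range_decreasing A m n :
  (m <= n)%N -> power_range A n `<=` power_range A m.
Proof.
have rangeS k : power_range A k.+1 `<=` power_range A k.
  by elim: k => // k IH; exact: image_subset.
move=> /subnK <-; elim: (n - m)%N => // k IH.
exact: subset_trans (rangeS _) IH.
Qed.

(** For e m in the m-th range, a unit vector orthogonal to the next range, and
m < n, T (e m) differs from l *: e m by A (e m), which is in the next range, and
so is T (e n): by orthogonality T (e m) and T (e n) are at distance at least
|l|. *)
Lemma sub_scalar_surjective T (l : K) : compact_operator T -> l != 0 ->
  bounded_below (T \- l \*: idfun) ->
  forall y, exists x, (T \- l \*: idfun) x = y.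
Proof.
move=> HT l0; set A : {linear H -> H} := T \- l \*: idfun => A_below.
have A_bounded : bounded_operator A.
  apply: bounded_operator_sub_scalar.
  exact: (compact_operator_bounded HK HT).
have TA x : T x = A x + l *: x by rewrite /A /= subrK.
have R_closed n : closed_subspace (power_range A n).
  by elim: n => [|n IH]; [split|exact: closed_image].
move=> y; apply/not_notP => y_notin.
(* Since A is injective, a y outside of its range makes all inclusions
   between successive ranges strict. *)
have y_range n : power_range A n (iter n A y) /\
                 ~ power_range A n.+1 (iter n A y).
  elim: n => [|n [IH1 IH2]].
    by split=> // -[x _ xy]; apply: y_notin; exists x.
  split; first by exists (iter n A y).
  move=> [x Rx /(bounded_below_injective A_below)] /= xy.
  by apply: IH2; rewrite -[iter n A y]xy.
have /choice [e eP] n : exists e, [/\ power_range A n e, `|e| = 1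
    & forall m, power_range A n.+1 m -> dot e m = 0].
  have [p [Rp py]] :=
    orthogonal_projection HK Hdot (iter n A y) (R_closed n.+1).
  have [Ry nRy] := y_range n.
  have yp0 : iter n A y - p != 0.
    by apply/eqP => /subr0_eq yp; apply: nRy; rewrite yp.
  exists (`|iter n A y - p|^-1 *: (iter n A y - p)); split.
  - apply: subspaceZ => //; apply: subspaceB => //.
    exact: power_range_decreasing Rp.
  - by rewrite normrZ normfV normr_id mulVf ?normr_eq0.
  - by move=> m Rm; rewrite dotZl py// mulr0.
apply: (compact_operator_not_separated HT (v := e) (c := `|l|)).
- by move=> n; have [_ ->] := eP n.
- by rewrite normr_gt0.
move=> m n mn; have [Rm em me] := eP m; have [Rn _ _] := eP n.
have -> : T (e m) - T (e n) = l *: e m + (A (e m) - T (e n)).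
  by rewrite TA addrAC [RHS]addrC addrAC.
have <- : `|l *: e m| = `|l| by rewrite normrZ em mulr1.
apply: (ler_norm_orthogonal Hdot); rewrite dotZl me ?mulr0//.
apply: subspaceB => //; first by exists (e m).
have Rn' : power_range A m.+1 (e n) by exact: power_range_decreasing Rn.
rewrite TA; apply: subspaceD => //; last exact: subspaceZ.
by apply: (power_range_decreasing (n := n.+1)); [exact: ltnW|exists (e n)].
Qed.

Lemma bounded_inverse A : bounded_below A -> (forall y, exists x, A x = y) ->
  exists S, [/\ continuous S, cancel A S & cancel S A].
Proof.
move=> A_below /choice [S AS]; have A_inj := bounded_below_injective A_below.
have SL : linear S by move=> a u v; apply: A_inj; rewrite linearP !AS.
pose S' : {linear H -> H} := HB.pack S (GRing.isLinear.Build _ _ _ _ S SL).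
exists S'; split=> // [|x]; last by apply: A_inj; exact: AS.
apply/bounded_operator_continuous; have [C C_gt0 AC] := A_below.
by exists C => // x; rewrite (le_trans (AC _))//= AS.
Qed.

Lemma adjoint_sub_scalar T S (l : K) : is_adjoint dot T S ->
  is_adjoint dot (T \- l \*: idfun) (S \- conj l \*: idfun).
Proof.
move=> TS x y; rewrite /= linearBl linearBr /= TS dotZl dotZr.
by rewrite (conj_involutive HK).
Qed.

(** The default value of [adjoint] is not taken, by [adjoint_exists]. *)
Lemma adjointP T : bounded_operator T -> is_adjoint dot T (adjoint dot T).
Proof.
move=> [C C_gt0 TC]; rewrite /adjoint; case: pselect => [ex|[]].
  exact: (projT2 (cid ex)).
exact: adjoint_exists C_gt0 TC.
Qed.

(** The preimage of y under S represents the functional x |-> <S' x, y>. *)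
Lemma adjoint_surjective A S S' : is_adjoint dot A S ->
  continuous S' -> cancel A S' -> forall y, exists z, S z = y.
Proof.
move=> AS /bounded_operator_continuous [C C_gt0 S'C] AK y.
have [z zP] := adjoint_exists HK Hdot C_gt0 S'C.
exists (z y); apply: (dot_injr Hdot) => x.
by rewrite -AS -zP AK.
Qed.

End FredholmAlternative.

(** * The category of proper subspaces *)

(** The vertex of [delta R] is the range of R: operators with the same family
of restrictions are both surjective or both not. *)
Lemma TP_deltaE (K : numFieldType) (H : lmodType K) (S : {linear H -> H}) :
  TP H (delta S) <-> ~ forall y, exists x, S x = y.
Proof.
have surjE (R : {linear H -> H}) :
    set_surj [set: H] [set: H] R <-> {subset predT <= range_pred R}.
  split=> [RT y _|RT y _]; first by rewrite unfold_in inE; exact: RT.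
  by have := RT y isT; rewrite unfold_in inE.
have -> : (forall y, exists x, S x = y) = set_surj [set: H] [set: H] S.
  apply/propext; split=> [ST y _|ST y]; first by have [x <-] := ST y; exists x.
  by have [x _ <-] := ST y Logic.I; exists x.
split=> [[R nR RS] ST|nST]; last by exists S.
apply: nR; apply/surjE => y yT; have /surjE/(_ y yT) := ST.
by rewrite -[range_pred R]/(vertex (delta R) : {pred H}) RS.
Qed.

Theorem theorem10 (K : numFieldType) (conj : {rmorphism K -> K})
    (HK : real_or_complex conj)
    (H : completeNormedModType K) (dot : {dot H for conj})
    (Hdot : forall x : H, `|x| ^+ 2 = dot x x)
    (Hinf : infinite_dimensional H)
    (T : {linear H -> H}) (HT : compact_operator T) :
  spectrum T =
  [set lambda : K |
    TP H (delta (adjoint dot T \- conj lambda \*: idfun))].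
Proof.
have T_bounded : bounded_operator T := compact_operator_bounded HK HT.
have TS := adjointP HK Hdot T_bounded.
apply/seteqP; split=> l; rewrite /spectrum /=.
  move=> l_spec; apply/TP_deltaE => S_surj; apply: l_spec.
  have A_below := adjoint_surj_bounded_below HK Hdot
    (adjoint_sub_scalar HK l TS) S_surj.
  apply: bounded_inverse => //.
  apply: (sub_scalar_surjective HK Hdot HT) => //.
  apply/eqP => l0; apply: (compact_not_bounded_below Hdot HT Hinf).
  have [C C_gt0 AC] := A_below; exists C => // x.
  by have := AC x; rewrite /= l0 scale0r subr0.
move=> /TP_deltaE S_nsurj [S' [S'_cont AK _]]; apply: S_nsurj.
exact: (adjoint_surjective HK Hdot (adjoint_sub_scalar HK l TS) S'_cont AK).
Qed.
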